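(* Let $N\ge1$, let $\theta_i=\frac{i\pi}{N}$ and $x_i=\cos\theta_i$ for $i=0,\ldots,N$, and let $s_i=[x_i,x_{i-1}]$ for $i=1,\ldots,N$. For $m\ge0$ let $\boldsymbol b_m\in\mathbb R^N$ have entries $[\boldsymbol b_m]_i=\int_{\theta_{i-1}}^{\theta_i}\cos(m\theta)\,d\theta$, $i=1,\ldots,N$. For each $Q\in\{T,U,V,W\}$ and $j=0,\ldots,N-1$ let $\psi_{j+1}^Q\in\Pi_N$ be the polynomial determined by $\int_{-1}^1\psi_{j+1}^Q(x)\,\omega_Q(x)\,dx=0$ and by the following derivative: - $(\psi_{j+1}^T)'=T_j$; - if $j\equiv N-2\pmod 2$, $(\psi_{j+1}^U)'=2\sum_{q=0}^{(N-2-j)/2}U_{j+2q}$; if $j\equiv N-1\pmod 2$, $(\psi_{j+1}^U)'=2\sum_{q\ge0,\ j+2q\le N-3}U_{j+2q}+\frac{N+1}{N}U_{N-1}$; - $(\psi_{j+1}^V)'=\sum_{m=j}^{N-1}(-1)^{m-j}V_m$; - $(\psi_{j+1}^W)'=\sum_{m=j}^{N-1}W_m$. Let $D_{\Psi^Q,N}\in\mathbb R^{N\times N}$ be the matrix with entries $[D_{\Psi^Q,N}]_{ik}=\int_{s_i}(\psi_k^Q)'(x)\,\omega_Q(x)\,dx$, $i,k=1,\ldots,N$. Then, for every $Q\in\{T,U,V,W\}$, the $(j+1)$-th column of $D_{\Psi^Q,N}$ is $\boldsymbol b_j$ for $j=0,\ldots,N-1$, and \[ D_{\Psi^Q,N}^\top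 D_{\Psi^Q,N}=\operatorname{diag}(\lambda_1,\ldots,\lambda_N),\qquad \lambda_1=\frac{\pi^2}{N},\quad \lambda_k=\frac{2N}{(k-1)^2}\sin^2\left(\frac{(k-1)\pi}{2N}\right),\ k=2,\ldots,N . \]
   Context: $\Pi_N$ is the space of real univariate polynomials of degree at most $N$. $T_m,U_m,V_m,W_m$ are the Chebyshev polynomials of the first, second, third and fourth kind: $T_m(\cos\theta)=\cos(m\theta)$, $U_m(\cos\theta)=\frac{\sin((m+1)\theta)}{\sin\theta}$, $V_m(\cos\theta)=\frac{\cos((m+\frac12)\theta)}{\cos(\theta/2)}$, $W_m(\cos\theta)=\frac{\sin((m+\frac12)\theta)}{\sin(\theta/2)}$. The associated weights on $(-1,1)$ are $\omega_T(x)=\frac1{\sqrt{1-x^2}}$, $\omega_U(x)=\sqrt{1-x^2}$, $\omega_V(x)=\sqrt{\frac{1+x}{1-x}}$, $\omega_W(x)=\sqrt{\frac{1-x}{1+x}}$. *)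

(* Defs.v *)
From HB Require Import structures.
From mathcomp Require Import all_boot all_order all_algebra.
From mathcomp Require Import all_classical all_reals all_analysis.
From mathcomp Require Import ring.

Set Implicit Arguments.
Unset Strict Implicit.
Unset Printing Implicit Defensive.

Import Order.TTheory GRing.Theory Num.Theory.
Import numFieldNormedType.Exports.

Local Open Scope classical_set_scope.
Local Open Scope ring_scope.

Inductive chebKind := KindT | KindU | KindV | KindW.

Section Defs.
Context {R : realType}.
Implicit Types (N m j : nat) (x t : R) (p : {poly R}) (Q : chebKind).

(* [xget 0 P] is the element of P when P is a singleton.  The quotients in
   the defining identities are only required where they make sense. *)
Definition chebT m : {poly R} :=
  xget 0 [set p : {poly R} | forall t, p.[cos t] = cos (m%:R * t)].

Definition chebU m : {poly R} :=
  xget 0 [set p : {poly R} | forall t, sin t != 0 ->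
    p.[cos t] = sin (m.+1%:R * t) / sin t].

Definition chebV m : {poly R} :=
  xget 0 [set p : {poly R} | forall t, cos (t / 2) != 0 ->
    p.[cos t] = cos ((m%:R + 2^-1) * t) / cos (t / 2)].

Definition chebW m : {poly R} :=
  xget 0 [set p : {poly R} | forall t, sin (t / 2) != 0 ->
    p.[cos t] = sin ((m%:R + 2^-1) * t) / sin (t / 2)].

(* Only the values on ]-1, 1[ matter: the endpoints are a null set. *)
Definition weight Q x : R :=
  match Q with
  | KindT => (Num.sqrt (1 - x ^+ 2))^-1
  | KindU => Num.sqrt (1 - x ^+ 2)
  | KindV => Num.sqrt ((1 + x) / (1 - x))
  | KindW => Num.sqrt ((1 - x) / (1 + x))
  end.

(* The derivative of psi_{j+1}.  For j < N, [odd j == odd N] means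
   j = N - 2 modulo 2, and it forces j <= N - 2; [j + 2 * q + 3 <= N] is
   j + 2 q <= N - 3 without truncated subtraction. *)
Definition dpsi Q N j : {poly R} :=
  match Q with
  | KindT => chebT j
  | KindU =>
      if odd j == odd N then
        2 *: \sum_(0 <= q < ((N - 2 - j)./2).+1) chebU (j + 2 * q)
      else
        2 *: \sum_(0 <= q < N | (j + 2 * q + 3 <= N)%N) chebU (j + 2 * q)
        + (N.+1%:R / N%:R) *: chebU N.-1
  | KindV => \sum_(j <= m < N) (-1) ^+ (m - j) *: chebV m
  | KindW => \sum_(j <= m < N) chebW m
  end.

(* The basis element psi_{j+1}, an element of Pi_N. *)
Definition psi Q N j : {poly R} :=
  xget 0 [set p : {poly R} | [/\ (size p <= N.+1)%N,
    \int[@lebesgue_measure R]_(x in `]-1, 1[) (p.[x] * weight Q x) = 0 &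
    p^`() = dpsi Q N j]].

Definition theta N i : R := i%:R * pi / N%:R.

Definition node N i : R := cos (theta N i).

(* Indices in 'I_N are 0-based: i : 'I_N stands for the interval
   s_{i+1} = [x_{i+1}, x_i], and k : 'I_N for psi_{k+1} and lambda_{k+1}. *)
Definition bvec N m : 'cV[R]_N :=
  \col_(i < N)
    \int[@lebesgue_measure R]_(t in `[theta N i, theta N i.+1]) cos (m%:R * t).

Definition Dpsi Q N : 'M[R]_N :=
  \matrix_(i < N, k < N)
    \int[@lebesgue_measure R]_(x in `[node N i.+1, node N i])
      ((psi Q N k)^`().[x] * weight Q x).

Definition lambda N (k : 'I_N) : R :=
  if k == 0%N :> nat then pi ^+ 2 / N%:R
  else 2 * N%:R / k%:R ^+ 2 * sin (k%:R * pi / (2 * N%:R)) ^+ 2.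

(* The four defining identities have solutions, by the common three-term
   recurrence; hence [chebT], ..., [chebW] satisfy them. *)
Fixpoint chebrec (p0 p1 : {poly R}) m : {poly R} :=
  match m with
  | 0%N => p0
  | m'.+1 => chebrec p1 ((2 : R) *: ('X * p1) - p0) m'
  end.

Lemma chebrecE (f : nat -> R) (c : R) p0 p1 m :
  p0.[c] = f 0%N -> p1.[c] = f 1%N ->
  (forall k, f k.+2 = 2 * (c * f k.+1) - f k) ->
  (chebrec p0 p1 m).[c] = f m.
Proof.
elim: m f p0 p1 => [|m IH] f p0 p1 h0 h1 hf //=.
apply: (IH (fun k => f k.+1)) => //.
by rewrite hf hornerD hornerN hornerZ (mulrC _ p1) hornerMX h0 h1; ring.
Qed.

Lemma cos_rec (a t : R) :
  cos (a + 2 * t) = 2 * (cos t * cos (a + t)) - cos a.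
Proof.
have -> : a + 2 * t = (a + t) + t by ring.
have -> : cos a = cos ((a + t) - t) by rewrite addrK.
by rewrite cosB [LHS]cosD; ring.
Qed.

Lemma sin_rec (a t : R) :
  sin (a + 2 * t) = 2 * (cos t * sin (a + t)) - sin a.
Proof.
have -> : a + 2 * t = (a + t) + t by ring.
have -> : sin a = sin ((a + t) - t) by rewrite addrK.
by rewrite sinB [LHS]sinD; ring.
Qed.

Lemma chebTE m t : (chebT m).[cos t] = cos (m%:R * t).
Proof.
suff hP : exists p : {poly R}, forall t, p.[cos t] = cos (m%:R * t).
  exact: (xgetPex 0 hP t).
exists (chebrec 1 'X m) => {}t.
apply: (@chebrecE (fun k => cos (k%:R * t))).
- by rewrite hornerC mul0r cos0.
- by rewrite hornerX mul1r.
move=> k; have -> : k.+2%:R * t = k%:R * t + 2 * t.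
  by rewrite -mulrDl -natrD addn2.
rewrite cos_rec; have -> // : k.+1%:R * t = k%:R * t + t.
by rewrite -addn1 natrD mulrDl mul1r.
Qed.

Lemma chebUE m t : sin t != 0 ->
  (chebU m).[cos t] = sin (m.+1%:R * t) / sin t.
Proof.
suff hP : exists p : {poly R}, forall t, sin t != 0 -> p.[cos t] = sin (m.+1%:R * t) / sin t.
  exact: (xgetPex 0 hP t).
exists (chebrec 1 (2 *: 'X) m) => {}t t0.
apply: (@chebrecE (fun k => sin (k.+1%:R * t) / sin t)).
- by rewrite hornerC mul1r divff.
- have -> : 2 * t = 0 + 2 * t by rewrite add0r.
  by rewrite sin_rec add0r sin0 subr0 hornerZ hornerX mulrA mulfK.
move=> k; have -> : k.+3%:R * t = k.+1%:R * t + 2 * t.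
  by rewrite -mulrDl -natrD addn2.
rewrite sin_rec; have -> : k.+2%:R * t = k.+1%:R * t + t.
  by rewrite -[k.+2]addn1 natrD mulrDl mul1r.
by rewrite mulrBl !mulrA.
Qed.

Lemma chebVE m t : cos (t / 2) != 0 ->
  (chebV m).[cos t] = cos ((m%:R + 2^-1) * t) / cos (t / 2).
Proof.
suff hP : exists p : {poly R}, forall t, cos (t / 2) != 0 ->
    p.[cos t] = cos ((m%:R + 2^-1) * t) / cos (t / 2).
  exact: (xgetPex 0 hP t).
exists (chebrec 1 (2 *: 'X - 1) m) => {}t t0.
apply: (@chebrecE (fun k => cos ((k%:R + 2^-1) * t) / cos (t / 2))).
- by rewrite hornerC add0r [2^-1 * t]mulrC divff.
- have -> : (1 + 2^-1) * t = - (t / 2) + 2 * t by field.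
  rewrite cos_rec cosN; have -> : - (t / 2) + t = t / 2 by field.
  by rewrite mulrBl divff // mulrA mulfK // !hornerE.
move=> k; have -> : (k.+2%:R + 2^-1) * t = (k%:R + 2^-1) * t + 2 * t.
  by rewrite -mulrDl -addn2 natrD addrAC.
rewrite cos_rec.
have -> : (k.+1%:R + 2^-1) * t = (k%:R + 2^-1) * t + t.
  by rewrite -addn1 natrD; ring.
by rewrite mulrBl !mulrA.
Qed.

Lemma chebWE m t : sin (t / 2) != 0 ->
  (chebW m).[cos t] = sin ((m%:R + 2^-1) * t) / sin (t / 2).
Proof.
suff hP : exists p : {poly R}, forall t, sin (t / 2) != 0 ->
    p.[cos t] = sin ((m%:R + 2^-1) * t) / sin (t / 2).
  exact: (xgetPex 0 hP t).
exists (chebrec 1 (2 *: 'X + 1) m) => {}t t0.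
apply: (@chebrecE (fun k => sin ((k%:R + 2^-1) * t) / sin (t / 2))).
- by rewrite hornerC add0r [2^-1 * t]mulrC divff.
- have -> : (1 + 2^-1) * t = - (t / 2) + 2 * t by field.
  rewrite sin_rec sinN; have -> : - (t / 2) + t = t / 2 by field.
  by rewrite opprK mulrDl divff // mulrA mulfK // !hornerE.
move=> k; have -> : (k.+2%:R + 2^-1) * t = (k%:R + 2^-1) * t + 2 * t.
  by rewrite -mulrDl -addn2 natrD addrAC.
rewrite sin_rec.
have -> : (k.+1%:R + 2^-1) * t = (k%:R + 2^-1) * t + t.
  by rewrite -addn1 natrD; ring.
by rewrite mulrBl !mulrA.
Qed.

End Defs.

(* Main.v *)
Require Import Defs.
From HB Require Import structures.
From mathcomp Require Import all_boot all_order all_algebra.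
From mathcomp Require Import all_classical all_reals all_analysis.
From mathcomp Require Import measurable_realfun.
From mathcomp Require Import ring lra zify.

Set Implicit Arguments.
Unset Strict Implicit.
Unset Printing Implicit Defensive.

Import Order.TTheory GRing.Theory Num.Theory.
Import numFieldNormedType.Exports.
Local Open Scope classical_set_scope.
Local Open Scope ring_scope.

(* Under x = cos t the density w_Q(x) dx becomes kappa_Q(cos t) dt, where the
   polynomial kappa_Q, [wpoly Q] below, is 1, 1 - x^2, 1 + x, 1 - x for
   Q = T, U, V, W.  By telescoping, kappa_Q times psi'_{j+1} is T_j plus a
   combination of T_{N-1}, T_N, T_{N+1} whose integral over every cell
   [theta_{i-1}, theta_i] vanishes; this gives the columns b_j.  The entries of
   b_j are a constant multiple of cos (j alpha_i) at the midpoints alpha_i of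
   the cells, so the Gram matrix is diagonal by discrete orthogonality.  The
   weights may blow up at the endpoints, so the change of variable is obtained
   by exhausting the open interval from inside. *)

(** * The substitution x = cos t on subintervals of ]-1, 1[ *)

Section ChangeOfVariable.
Context {R : realType}.
Notation mu := (@lebesgue_measure R).
Implicit Types (a b t x : R) (f : R -> R).

Lemma ltr_cos_pi a b : 0 <= a -> a < b -> b <= pi -> cos b < cos a.
Proof. by move=> a0 ab bpi; rewrite ltr_cos// in_itv/=; lra. Qed.

Lemma derive1_cos : derive1 (@cos R) = (fun t => - sin t).
Proof. by apply/funext => t; rewrite derive1E derive_val. Qed.

(** The strict bounds on [a] and [b] keep [cos b, cos a] inside ]-1, 1[, so [f] is continuous up to
    its endpoints and substitution along the decreasing function cos applies. *)
Lemma integral_cos_substitution_cc f a b : 0 < a -> a <= b -> b < pi ->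
  {in `]-1, 1[, continuous f} ->
  (\int[mu]_(x in `[cos b, cos a]) (f x)%:E =
   \int[mu]_(t in `[a, b]) (f (cos t) * sin t)%:E)%E.
Proof.
move=> a0 ab bpi cf.
have in0pi t : t \in `[a, b] -> t \in `[0, pi].
  rewrite !in_itv/= => /andP[at_ tb].
  by rewrite (le_trans (ltW a0) at_) (le_trans tb (ltW bpi)).
rewrite (@integration_by_substitution_decreasing _ cos f)//.
- apply: eq_integral => t _; congr (_%:E).
  by rewrite /= derive1_cos opprK.
- by move=> s t /in0pi hs /in0pi ht st; rewrite ltr_cos.
- by rewrite derive1_cos => t _; apply: continuousN; exact: continuous_sin.
- rewrite derive1_cos; apply/cvg_ex; exists (- sin a).
  by apply: cvg_at_right_filter; apply: continuousN; exact: continuous_sin.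
- rewrite derive1_cos; apply/cvg_ex; exists (- sin b).
  by apply: cvg_at_left_filter; apply: continuousN; exact: continuous_sin.
- split; first by move=> t _; exact: derivable_cos.
  + by apply: cvg_at_right_filter; exact: continuous_cos.
  + by apply: cvg_at_left_filter; exact: continuous_cos.
- apply: continuous_in_subspaceT => x; rewrite inE/= in_itv/= => /andP[bx xa].
  apply: cf; rewrite in_itv/=; apply/andP; split.
    by apply: lt_le_trans bx; rewrite -cospi ltr_cos_pi//; lra.
  by apply: (le_lt_trans xa); rewrite -cos0 ltr_cos_pi//; lra.
Qed.

Lemma ler_cos_pi a b : 0 <= a -> a <= b -> b <= pi -> cos b <= cos a.
Proof.
move=> a0; rewrite le_eqVlt => /predU1P[-> //|ab bpi].
by rewrite ltW// ltr_cos_pi.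
Qed.

(** With the divisor n + 2 the two endpoints are in order from the start: at n = 0 both are the
    midpoint. *)
Definition shrinkl a b n : R := a + (b - a) / n.+2%:R.
Definition shrinkr a b n : R := b - (b - a) / n.+2%:R.

Lemma shrinkP a b n : a < b ->
  [/\ a < shrinkl a b n, shrinkl a b n <= shrinkr a b n
    & shrinkr a b n < b].
Proof.
move=> ab; rewrite /shrinkl /shrinkr.
have h0 : 0 < (b - a) / n.+2%:R by rewrite divr_gt0 ?subr_gt0// ltr0n.
have h1 : (b - a) / n.+2%:R * 2 <= b - a.
  rewrite mulrAC ler_pdivrMr ?ltr0n// ler_pM2l ?subr_gt0//.
  by rewrite ler_nat.
by move: h0 h1; set q := _ / _ => h0 h1; split; lra.
Qed.

Lemma shrink_mono a b m n : a < b -> (m <= n)%N ->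
  shrinkl a b n <= shrinkl a b m /\ shrinkr a b m <= shrinkr a b n.
Proof.
move=> ab mn; rewrite /shrinkl /shrinkr.
have h : (b - a) / n.+2%:R <= (b - a) / m.+2%:R.
  by rewrite ler_pM2l ?subr_gt0// lef_pV2 ?posrE ?ltr0n// ler_nat !ltnS.
by move: h; set p := _ / _; set q := _ / _ => h; split; lra.
Qed.

Lemma shrink_exhaust a b t : a < t -> t < b ->
  exists n, shrinkl a b n <= t <= shrinkr a b n.
Proof.
move=> at_ tb.
have ab : 0 < b - a by rewrite subr_gt0 (lt_trans at_).
(* The distance from t to the nearer endpoint; any n above (b - a) / e will do. *)
pose e := Num.min (t - a) (b - t).
have e0 : 0 < e by rewrite lt_min !subr_gt0 at_.
have := archi_boundP (ltW (divr_gt0 ab e0)).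
set n := Num.Def.archi_bound _ => hn.
exists n; rewrite /shrinkl /shrinkr.
have h : (b - a) / n.+2%:R <= e.
  rewrite ler_pdivrMr ?ltr0n// mulrC -ler_pdivrMr//.
  by apply: (le_trans (ltW hn)); rewrite ler_nat; lia.
have [h1 h2] : e <= t - a /\ e <= b - t by rewrite !ge_min !lexx orbT.
by move: h; set q := _ / _ => h; lra.
Qed.

Lemma bigcup_shrink a b : a < b ->
  \bigcup_n `[shrinkl a b n, shrinkr a b n]%classic = `]a, b[%classic.
Proof.
move=> ab; apply/seteqP; split => [t [n _]|t] /=; rewrite !in_itv/=.
  by have [h1 h2 h3] := shrinkP n ab; move=> h4; lra.
by case/andP => /shrink_exhaust h /h[n hn]; exists n => //=; rewrite in_itv.
Qed.

Lemma bigcup_cos_shrink a b : 0 <= a -> a < b -> b <= pi ->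
  \bigcup_n `[cos (shrinkr a b n), cos (shrinkl a b n)]%classic =
  `]cos b, cos a[%classic.
Proof.
move=> a0 ab bpi; apply/seteqP; split => [x [n _]|x] /=; rewrite !in_itv/=.
  have [h1 h2 h3] := shrinkP n ab.
  move=> /andP[hx1 hx2]; apply/andP; split.
    by apply: lt_le_trans hx1; apply: ltr_cos_pi => //; lra.
  by apply: (le_lt_trans hx2); apply: ltr_cos_pi => //; lra.
case/andP => bx xa.
have x1 : -1 <= x <= 1.
  by rewrite (le_trans (cos_geN1 b) (ltW bx)) (le_trans (ltW xa) (cos_le1 a)).
(* Exhausting ]a, b[ at the angle [acos x] and mapping back by cos exhausts the image interval. *)
have ht : 0 <= acos x <= pi by rewrite acos_ge0// acos_lepi.
have hx : cos (acos x) = x by rewrite acosK// in_itv.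
have aI : a \in `[0, pi] by rewrite in_itv/=; lra.
have bI : b \in `[0, pi] by rewrite in_itv/=; lra.
have h1 : a < acos x by rewrite -ltr_cos ?in_itv// hx.
have h2 : acos x < b by rewrite -ltr_cos ?in_itv// hx.
have [n /andP[hn1 hn2]] := shrink_exhaust h1 h2.
have [h3 h4 h5] := shrinkP n ab.
by exists n => //=; rewrite in_itv/= -hx; apply/andP; split;
  apply: ler_cos_pi => //; lra.
Qed.

Lemma continuous_cos_sin_comp f : {in `]-1, 1[, continuous f} ->
  {in `]0, pi[, continuous (fun t => f (cos t) * sin t)}.
Proof.
move=> cf t; rewrite in_itv/= => /andP[t0 tpi].
apply: continuousM; last exact: continuous_sin.
apply: continuous_comp; first exact: continuous_cos.
apply: cf; rewrite in_itv/=; apply/andP; split.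
  by rewrite -cospi; apply: ltr_cos_pi => //; exact: ltW.
by rewrite -cos0; apply: ltr_cos_pi => //; exact: ltW.
Qed.

Lemma continuous_measurable_fun_oo f a b c d : a <= c -> d <= b ->
  {in `]a, b[, continuous f} -> measurable_fun `]c, d[ f.
Proof.
move=> ac db cf.
apply: open_continuous_measurable_fun; first exact: interval_open.
move=> x; rewrite inE/= in_itv/= => /andP[cx xd]; apply: cf.
by rewrite in_itv/=; lra.
Qed.

(** Both sides are limits of the closed-interval identity along the shrunken intervals, by monotone
    convergence; this is where the sign of [f] enters. *)
Lemma ge0_integral_cos_substitution_oo f a b :
  0 <= a -> a < b -> b <= pi -> {in `]-1, 1[, continuous f} ->
  (forall x, 0 <= f x) ->
  (\int[mu]_(x in `]cos b, cos a[) (f x)%:E =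
   \int[mu]_(t in `]a, b[) (f (cos t) * sin t)%:E)%E.
Proof.
move=> a0 ab bpi cf f0.
have hs n := shrinkP n ab.
have mf : measurable_fun `]cos b, cos a[ f.
  by apply: (continuous_measurable_fun_oo _ _ cf); rewrite ?cos_geN1 ?cos_le1.
have mg : measurable_fun `]a, b[ (fun t => f (cos t) * sin t).
  by apply: (continuous_measurable_fun_oo _ _ (continuous_cos_sin_comp cf)).
rewrite -(bigcup_shrink ab) -bigcup_cos_shrink// in mf mg *.
have L1 : (\int[mu]_(x in `[cos (shrinkr a b n), cos (shrinkl a b n)])
     (f x)%:E @[n --> \oo] -->
   \int[mu]_(x in \bigcup_n `[cos (shrinkr a b n), cos (shrinkl a b n)]%classic)
     (f x)%:E)%E.
  apply: ge0_nondecreasing_set_cvg_integral => //.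
  - move=> m n mn; apply/subsetPset => x /=; rewrite !in_itv/= => /andP[h1 h2].
    have [h3 h4] := shrink_mono ab mn.
    have [? ? ?] := hs n; have [? ? ?] := hs m.
    apply/andP; split.
      by apply: le_trans h1; apply: ler_cos_pi => //; lra.
    by apply: (le_trans h2); apply: ler_cos_pi => //; lra.
  - move=> n; apply/measurable_EFinP; apply: (measurable_funS _ _ mf) => //.
      by apply: bigcup_measurable => k _.
    by move=> x hx; exists n.
  - by move=> n x _; rewrite lee_fin.
have L2 : (\int[mu]_(t in `[shrinkl a b n, shrinkr a b n])
     (f (cos t) * sin t)%:E @[n --> \oo] -->
   \int[mu]_(t in \bigcup_n `[shrinkl a b n, shrinkr a b n]%classic)
     (f (cos t) * sin t)%:E)%E.
  apply: ge0_nondecreasing_set_cvg_integral => //.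
  - move=> m n mn; apply/subsetPset => x /=; rewrite !in_itv/= => /andP[h1 h2].
    by have [h3 h4] := shrink_mono ab mn; lra.
  - move=> n; apply/measurable_EFinP; apply: (measurable_funS _ _ mg) => //.
      by apply: bigcup_measurable => k _.
    by move=> x hx; exists n.
  - move=> n t /=; rewrite in_itv/= => ht; rewrite lee_fin mulr_ge0//.
    by apply: sin_ge0_pi; have [? ? ?] := hs n; lra.
rewrite -(cvg_lim _ L1)// -(cvg_lim _ L2)//; congr (limn _).
apply/funext => n; have [? ? ?] := hs n.
by apply: integral_cos_substitution_cc => //; lra.
Qed.

(** Since sin t >= 0 on ]a, b[, multiplying by sin t commutes with taking positive and negative
    parts, so the nonnegative case applies to each part. *)
Lemma integral_cos_substitution_oo f a b :
  0 <= a -> a < b -> b <= pi -> {in `]-1, 1[, continuous f} ->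
  (\int[mu]_(x in `]cos b, cos a[) (f x)%:E =
   \int[mu]_(t in `]a, b[) (f (cos t) * sin t)%:E)%E.
Proof.
move=> a0 ab bpi cf; rewrite integralE [RHS]integralE.
have sin0 t : t \in `]a, b[%classic -> 0 <= sin t.
  by rewrite inE/= in_itv/= => ?; apply: sin_ge0_pi; lra.
congr (_ - _)%E.
- under eq_integral do rewrite funeposE -EFin_max.
  rewrite (@ge0_integral_cos_substitution_oo (fun x => Num.max (f x) 0))//.
  + apply: eq_integral => t /sin0 st.
    by rewrite funeposE/= -EFin_max maxr_pMl// mul0r.
  + by move=> x xI; apply: continuous_max; [exact: cf|exact: cst_continuous].
  + by move=> x; rewrite le_max lexx orbT.
- under eq_integral do rewrite funenegE -EFinN -EFin_max.
  rewrite (@ge0_integral_cos_substitution_oo (fun x => Num.max (- f x) 0))//.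
  + apply: eq_integral => t /sin0 st.
    by rewrite funenegE/= -EFin_max maxr_pMl// mul0r mulNr.
  + move=> x xI; apply: (@continuous_max _ _ (fun y => - f y) (cst 0)).
      by apply: continuousN; exact: cf.
    exact: cst_continuous.
  + by move=> x; rewrite le_max lexx orbT.
Qed.

End ChangeOfVariable.

(** * Products of Chebyshev polynomials with kappa_Q, and degree bounds *)

Section ChebyshevIdentities.
Context {R : realType}.
Implicit Types (N m n j : nat) (t : R) (p q : {poly R}) (Q : chebKind).

Lemma poly_cos_ext p q :
  (forall t, 0 < t < pi -> p.[cos t] = q.[cos t]) -> p = q.
Proof.
move=> pq; apply/eqP; rewrite -subr_eq0; apply/eqP.
(* The points 1 / (k + 2) lie in ]0, 1[ and are cosines of angles in ]0, pi[; as many distinct roots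
   as the size of p - q force p - q = 0. *)
pose s := [seq (k.+2%:R : R)^-1 | k <- iota 0 (size (p - q))].
have inj : injective (fun k : nat => (k.+2%:R : R)^-1).
  by move=> k l /invr_inj/eqP; rewrite eqr_nat => /eqP[].
apply: (@roots_geq_poly_eq0 _ _ s).
- apply/allP => _ /mapP[k _ ->].
  have k1 : (k.+2%:R : R)^-1 < 1 by rewrite invf_lt1 ?ltr0n// ltr1n.
  have k0 : 0 < (k.+2%:R : R)^-1 by rewrite invr_gt0 ltr0n.
  have hk : -1 < (k.+2%:R : R)^-1 < 1.
    by rewrite k1 andbT (lt_trans _ k0)// ltrN10.
  move: hk {k0 k1}; set x := _^-1 => hk.
  have hx : cos (acos x) = x by rewrite acosK// in_itv/=; lra.
  rewrite rootE hornerD hornerN -hx pq ?subrr//.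
  by rewrite acos_gt0 ?acos_ltpi//; lra.
- by rewrite map_inj_uniq// iota_uniq.
- by rewrite size_map size_iota.
Qed.

Lemma cos_half_gt0 t : 0 < t < pi -> 0 < cos (t / 2).
Proof. by move=> t0pi; apply: cos_gt0_pihalf; lra. Qed.

Lemma sin_half_gt0 t : 0 < t < pi -> 0 < sin (t / 2).
Proof. by move=> t0pi; apply: sin_gt0_pi; lra. Qed.

Lemma chebT0 : chebT 0 = 1 :> {poly R}.
Proof. by apply: poly_cos_ext => t _; rewrite chebTE mul0r cos0 hornerC. Qed.

Lemma chebT1 : chebT 1 = 'X :> {poly R}.
Proof. by apply: poly_cos_ext => t _; rewrite chebTE mul1r hornerX. Qed.

Lemma chebTS m : chebT m.+2 = 2 *: ('X * chebT m.+1) - chebT m :> {poly R}.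
Proof.
apply: poly_cos_ext => t _.
rewrite hornerD hornerN hornerZ (mulrC 'X) hornerMX !chebTE.
have -> : m.+2%:R * t = m%:R * t + 2 * t by rewrite -mulrDl -natrD addn2.
have -> : m.+1%:R * t = m%:R * t + t by rewrite -[m.+1]addn1 natrD mulrDl mul1r.
by rewrite cos_rec; ring.
Qed.

Lemma size_chebT m : (size (chebT m : {poly R}) <= m.+1)%N.
Proof.
elim/ltn_ind: m => -[|[|m]] IH.
- by rewrite chebT0 size_poly1.
- by rewrite chebT1 size_polyX.
rewrite chebTS (leq_trans (size_polyD _ _))// geq_max size_polyN.
rewrite (leq_trans (size_scale_leq _ _))/=; last first.
  by rewrite mulrC (leq_trans (size_polyMleq _ _))// size_polyX addn2/= ltnS IH.
by rewrite (leq_trans (IH _ _))// -addn2 leq_addr.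
Qed.

Definition wpoly Q : {poly R} :=
  match Q with
  | KindT => 1
  | KindU => 1 - 'X ^+ 2
  | KindV => 1 + 'X
  | KindW => 1 - 'X
  end.

Lemma horner_wpoly Q (x : R) : (wpoly Q).[x] =
  match Q with
  | KindT => 1
  | KindU => 1 - x ^+ 2
  | KindV => 1 + x
  | KindW => 1 - x
  end.
Proof. by case: Q; rewrite /wpoly !hornerE ?expr2. Qed.

(** The Jacobian sin t removes the square root, because sin^2 t = (1 - cos t)(1 + cos t) and sin t >
    0. *)
Lemma weight_cos Q t : 0 < t < pi ->
  weight Q (cos t) * sin t = (wpoly Q).[cos t].
Proof.
move=> t0pi; have s0 := sin_gt0_pi t0pi.
have s2 : sin t ^+ 2 = 1 - cos t ^+ 2 := sin2cos2 t.
have sn0 : sin t != 0 by rewrite gt_eqF.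
have c1 : 0 < 1 - cos t by rewrite subr_gt0 -cos0 ltr_cos_pi//; lra.
have c2 : 0 < 1 + cos t.
  by rewrite -(opprK 1) addrC subr_gt0 -cospi ltr_cos_pi//; lra.
have n1 := lt0r_neq0 c1; have n2 := lt0r_neq0 c2.
rewrite horner_wpoly; case: Q => /=.
- by rewrite -s2 sqrtr_sqr gtr0_norm// mulVf.
- by rewrite -s2 sqrtr_sqr gtr0_norm// expr2.
(* Expanding the fraction by 1 + cos t makes it a perfect square. *)
- have -> : (1 + cos t) / (1 - cos t) = ((1 + cos t) / sin t) ^+ 2.
    rewrite expr_div_n s2.
    have -> : 1 - cos t ^+ 2 = (1 - cos t) * (1 + cos t) by ring.
    by field; rewrite n1 n2.
  rewrite sqrtr_sqr ger0_norm ?divfK//.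
  by rewrite divr_ge0// ltW.
- have -> : (1 - cos t) / (1 + cos t) = ((1 - cos t) / sin t) ^+ 2.
    rewrite expr_div_n s2.
    have -> : 1 - cos t ^+ 2 = (1 - cos t) * (1 + cos t) by ring.
    by field; rewrite n1 n2.
  rewrite sqrtr_sqr ger0_norm ?divfK//.
  by rewrite divr_ge0// ltW.
Qed.

(** Here kappa_U = sin^2 t cancels the denominator of U_m, and 2 sin t sin((m+1)t) splits by the
    product-to-sum formula. For V and W below, 1 + cos t = 2 cos^2(t/2) and 1 - cos t = 2 sin^2(t/2)
    play the same role. *)
Lemma chebU_wpoly m :
  2 *: (chebU m * wpoly KindU) = chebT m - chebT m.+2 :> {poly R}.
Proof.
apply: poly_cos_ext => t t0pi; have s0 := lt0r_neq0 (sin_gt0_pi t0pi).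
rewrite hornerZ hornerM hornerD hornerN !chebTE chebUE// horner_wpoly -sin2cos2.
have -> : m%:R * t = m.+1%:R * t - t by rewrite -[m.+1]addn1 natrD; ring.
have -> : m.+2%:R * t = m.+1%:R * t + t by rewrite -[m.+2]addn1 natrD; ring.
by rewrite cosB cosD; field.
Qed.

Lemma chebV_wpoly m :
  chebV m * wpoly KindV = chebT m + chebT m.+1 :> {poly R}.
Proof.
apply: poly_cos_ext => t t0pi; have c0 := lt0r_neq0 (cos_half_gt0 t0pi).
rewrite hornerM hornerD !chebTE chebVE// horner_wpoly.
have -> : m%:R * t = (m%:R + 2^-1) * t - t / 2 by field.
have -> : m.+1%:R * t = (m%:R + 2^-1) * t + t / 2.
  by rewrite -[m.+1]addn1 natrD; field.
have -> : cos t = 2 * cos (t / 2) ^+ 2 - 1.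
  by rewrite [in LHS](splitr t) cosD -!expr2 sin2cos2; ring.
by rewrite cosB cosD; field.
Qed.

Lemma chebW_wpoly m :
  chebW m * wpoly KindW = chebT m - chebT m.+1 :> {poly R}.
Proof.
apply: poly_cos_ext => t t0pi; have c0 := lt0r_neq0 (sin_half_gt0 t0pi).
rewrite hornerM hornerD hornerN !chebTE chebWE// horner_wpoly.
have -> : m%:R * t = (m%:R + 2^-1) * t - t / 2 by field.
have -> : m.+1%:R * t = (m%:R + 2^-1) * t + t / 2.
  by rewrite -[m.+1]addn1 natrD; field.
have -> : cos t = 1 - 2 * sin (t / 2) ^+ 2.
  by rewrite [in LHS](splitr t) cosD -!expr2 cos2sin2; ring.
by rewrite cosB cosD; field.
Qed.

(** The step 2 in the index matches the gap between T_m and T_(m+2), so the sum telescopes; the V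
    sum needs alternating signs for this, the W sum none. *)
Lemma sum_chebU_wpoly j n :
  (2 *: \sum_(0 <= q < n) chebU (j + 2 * q)) * wpoly KindU =
  chebT j - chebT (j + 2 * n) :> {poly R}.
Proof.
elim: n => [|n IH]; first by rewrite big_nil scaler0 mul0r muln0 addn0 subrr.
rewrite big_nat_recr//= scalerDr mulrDl IH -scalerAl chebU_wpoly.
by rewrite addrA subrK mulnS addnCA add2n.
Qed.

Lemma sum_chebV_wpoly j n :
  (\sum_(j <= m < j + n) (-1) ^+ (m - j) *: chebV m) * wpoly KindV =
  chebT j - (-1) ^+ n *: chebT (j + n) :> {poly R}.
Proof.
elim: n => [|n IH]; first by rewrite addn0 big_geq// mul0r scale1r subrr.
rewrite addnS big_nat_recr ?leq_addr//= mulrDl IH -scalerAl chebV_wpoly.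
by rewrite addKn exprS mulN1r scaleNr opprK scalerDr addrA subrK.
Qed.

Lemma sum_chebW_wpoly j n :
  (\sum_(j <= m < j + n) chebW m) * wpoly KindW =
  chebT j - chebT (j + n) :> {poly R}.
Proof.
elim: n => [|n IH]; first by rewrite addn0 big_geq// mul0r subrr.
by rewrite addnS big_nat_recr ?leq_addr//= mulrDl IH chebW_wpoly addrA subrK.
Qed.

(* What [dpsi Q N j * wpoly Q] contains besides T_j. *)
Definition dpsi_rem Q N j : {poly R} :=
  match Q with
  | KindT => 0
  | KindU =>
      if odd j == odd N then - chebT N
      else - chebT N.-1 +
           (N.+1%:R / (2 * N%:R)) *: (chebT N.-1 - chebT N.+1)
  | KindV => - ((-1) ^+ (N - j) *: chebT N)
  | KindW => - chebT N
  end.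

Lemma dpsi_wpoly Q N j : (j < N)%N ->
  dpsi Q N j * wpoly Q = chebT j + dpsi_rem Q N j.
Proof.
move=> jN; have jNE : N = (j + (N - j))%N by lia.
case: Q; rewrite /dpsi /dpsi_rem.
- by rewrite mulr1 addr0.
- case: ifPn => parity.
    by rewrite sum_chebU_wpoly; congr (_ - chebT _); lia.
  (* When N - 1 - j is even, j + 2q + 3 <= N means exactly q < (N - 1 - j) / 2, so the filtered sum
     is an initial segment and telescopes down to T_(N-1). *)
  have -> : (\sum_(0 <= q < N | (j + 2 * q + 3 <= N)%N) chebU (j + 2 * q) =
             \sum_(0 <= q < (N.-1 - j)./2) chebU (j + 2 * q) :> {poly R})%R.
    rewrite [RHS](big_nat_widen _ _ N); last by lia.
    by apply: eq_bigl => q /=; lia.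
  rewrite mulrDl sum_chebU_wpoly -addrA; congr (_ + _).
  have -> : (j + 2 * (N.-1 - j)./2)%N = N.-1 by lia.
  congr (_ + _); rewrite -(_ : chebT N.-1.+2 = chebT N.+1); last first.
    by congr chebT; lia.
  by rewrite -chebU_wpoly scalerA -scalerAl; congr (_ *: _); field;
    rewrite pnatr_eq0; lia.
- by rewrite [in LHS]jNE sum_chebV_wpoly -jNE.
- by rewrite [in LHS]jNE sum_chebW_wpoly -jNE.
Qed.

Lemma size_wpoly Q : size (wpoly Q) =
  (match Q with KindT => 1 | KindU => 3 | KindV => 2 | KindW => 2 end)%N.
Proof.
case: Q => /=; first exact: size_poly1.
- by rewrite -opprB size_polyN size_XnsubC.
- by rewrite addrC size_XaddC.
- by rewrite -opprB size_polyN size_XsubC.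
Qed.

(** The degree is read off the product with kappa_Q: sizes of nonzero factors add up to one more
    than that of the product, and the product is a combination of T_m with m <= N + 1. *)
Lemma size_dpsi Q N j : (j < N)%N -> (size (dpsi Q N j : {poly R}) <= N)%N.
Proof.
move=> jN; have [->|d0] := eqVneq (dpsi Q N j : {poly R}) 0.
  by rewrite size_poly0.
have w0 : wpoly Q != 0 by rewrite -size_poly_gt0 size_wpoly; case: (Q).
have := size_mul d0 w0; rewrite dpsi_wpoly// size_wpoly => e.
have sD (p q : {poly R}) k :
    (size p <= k)%N -> (size q <= k)%N -> (size (p + q)%R <= k)%N.
  by move=> hp hq; rewrite (leq_trans (size_polyD _ _))// geq_max hp.
have sT m k : (m < k)%N -> (size (chebT m : {poly R}) <= k)%N.
  by move=> mk; rewrite (leq_trans (size_chebT m)).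
suff : (size (chebT j + dpsi_rem Q N j)%R <=
  N + match Q with KindT => 0 | KindU => 2 | KindV => 1 | KindW => 1 end)%N.
  by rewrite e; move: (size _) => s {e sD sT w0 d0}; case: Q; lia.
apply: (sD); first by apply: (sT); lia.
case: (Q); rewrite /dpsi_rem ?size_poly0//.
- case: ifP => _; first by rewrite size_polyN; apply: (sT); lia.
  apply: (sD); first by rewrite size_polyN; apply: (sT); lia.
  rewrite (leq_trans (size_scale_leq _ _))//.
  by apply: (sD); rewrite ?size_polyN; apply: (sT); lia.
- by rewrite size_polyN (leq_trans (size_scale_leq _ _))//; apply: (sT); lia.
- by rewrite size_polyN; apply: (sT); lia.
Qed.

End ChebyshevIdentities.

Lemma poly_antiderivative (F : numFieldType) (d : {poly F}) n :
  (size d <= n)%N -> exists2 p : {poly F}, (size p <= n.+1)%N & p^`() = d.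
Proof.
move=> dn.
(* At i = 0 the division by zero gives the constant coefficient 0. *)
exists (\poly_(i < n.+1) (d`_i.-1 / i%:R)); first exact: size_poly.
apply/polyP => i; rewrite coef_deriv coef_poly ltnS /=.
case: ltnP => [_|ni]; first by rewrite -[LHS]mulr_natr divfK// pnatr_eq0.
by rewrite mul0rn nth_default// (leq_trans dn).
Qed.

(** * Weighted integrals as integrals of polynomials in cos t, and existence of psi *)

Section WeightedIntegrals.
Context {R : realType}.
Notation mu := (@lebesgue_measure R).
Implicit Types (a b t x : R) (p q : {poly R}) (Q : chebKind).

Lemma continuous_weight Q : {in `]-1, 1[, continuous (@weight R Q)}.
Proof.
move=> x; rewrite in_itv/= => /andP[x1 x2].
have c1 : {for x, continuous (fun y : R => 1 - y)}.
  by apply: continuousB; [exact: cst_continuous|exact: id].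
have c2 : {for x, continuous (fun y : R => 1 + y)}.
  by apply: continuousD; [exact: cst_continuous|exact: id].
have c3 : {for x, continuous (fun y : R => Num.sqrt (1 - y ^+ 2))}.
  apply: (@continuous_comp _ _ _ (fun y : R => 1 - y ^+ 2)); last first.
    exact: sqrt_continuous.
  by apply: continuousB; [exact: cst_continuous|exact: exprn_continuous].
have n1 : 1 - x != 0 by rewrite subr_eq0 gt_eqF.
have n2 : 1 + x != 0 by rewrite gt_eqF//; lra.
case: Q => //=.
- apply: (continuousV _ c3) => /=.
  by rewrite gt_eqF// sqrtr_gt0; nra.
- apply: (@continuous_comp _ _ _ (fun y : R => (1 + y) / (1 - y))); last first.
    exact: sqrt_continuous.
  by apply: continuousM => //; exact: continuousV.
- apply: (@continuous_comp _ _ _ (fun y : R => (1 - y) / (1 + y))); last first.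
    exact: sqrt_continuous.
  by apply: continuousM => //; exact: continuousV.
Qed.

Lemma continuous_horner_weight p Q :
  {in `]-1, 1[, continuous (fun x => p.[x] * weight Q x)}.
Proof.
move=> x xI; apply: continuousM; last exact: continuous_weight.
exact: continuous_horner.
Qed.

Lemma continuous_horner_cos p : continuous (fun t => p.[cos t]).
Proof.
move=> t; apply: continuous_comp; first exact: continuous_cos.
exact: continuous_horner.
Qed.

Lemma integrable_horner_cos p a b :
  mu.-integrable `[a, b] (EFin \o (fun t => p.[cos t])).
Proof.
apply: continuous_compact_integrable; first exact: segment_compact.
by apply: continuous_subspaceT; exact: continuous_horner_cos.
Qed.

Lemma horner_weight_cos p Q t : 0 < t < pi ->
  p.[cos t] * weight Q (cos t) * sin t = (p * wpoly Q).[cos t].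
Proof. by move=> t0pi; rewrite -mulrA weight_cos// hornerM. Qed.

(** Dropping the null endpoints allows the substitution on open intervals; they are restored on the
    t side, where the integrand is continuous everywhere. *)
Lemma Rintegral_horner_weight p Q a b : 0 <= a -> a < b -> b <= pi ->
  \int[mu]_(x in `[cos b, cos a]) (p.[x] * weight Q x) =
  \int[mu]_(t in `[a, b]) (p * wpoly Q).[cos t].
Proof.
move=> a0 ab bpi; rewrite /Rintegral; congr fine.
rewrite integral_itv_bndoo; last first.
  apply/measurable_EFinP.
  by apply: (continuous_measurable_fun_oo _ _ (@continuous_horner_weight p Q));
    rewrite ?cos_geN1 ?cos_le1.
rewrite integral_cos_substitution_oo//; last exact: continuous_horner_weight.
rewrite [RHS]integral_itv_bndoo; last first.
  apply/measurable_EFinP; apply: (@continuous_measurable_fun_oo _ _ a b) => //.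
  by move=> t _; exact: continuous_horner_cos.
apply: eq_integral => t; rewrite inE/= in_itv/= => tab.
by rewrite horner_weight_cos//; lra.
Qed.

(** The substitution applied to the absolute value turns it into |(p kappa_Q)(cos t)|, continuous on
    the compact [0, pi]. *)
Lemma integrable_horner_weight p Q :
  mu.-integrable `]-1, 1[ (EFin \o (fun x => p.[x] * weight Q x)).
Proof.
apply/integrableP; split.
  apply/measurable_EFinP.
  exact: (continuous_measurable_fun_oo _ _ (@continuous_horner_weight p Q)).
have [_] := integrableP _ _ _ (integrable_horner_cos (p * wpoly Q) 0 pi).
apply: le_lt_trans.
have -> : `]-1, 1[%classic = `]cos pi, cos 0[%classic :> set R.
  by rewrite cospi cos0.
rewrite (@integral_cos_substitution_oo _ (fun x => `|p.[x] * weight Q x|))//;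
  first last.
- move=> x xI; apply: (@continuous_comp _ _ _ (fun x => p.[x] * weight Q x)).
    exact: continuous_horner_weight.
  exact: norm_continuous.
- exact: pi_gt0.
under eq_integral => t.
  rewrite inE/= in_itv/= => tI.
  rewrite -(gtr0_norm (sin_gt0_pi tI)) -normrM horner_weight_cos//.
  over.
apply: ge0_subset_integral => //=.
- apply/measurable_EFinP; apply: measurableT_comp => //.
  apply/measurable_EFinP; apply: (measurable_int mu).
  exact: integrable_horner_cos.
- exact: subset_itv_oo_cc.
Qed.

Definition cosI a b p : R := \int[mu]_(t in `[a, b]) p.[cos t].

Lemma cosID a b p q : cosI a b (p + q) = cosI a b p + cosI a b q.
Proof.
rewrite /cosI; under eq_Rintegral do rewrite hornerD.
by rewrite RintegralD//; exact: integrable_horner_cos.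
Qed.

Lemma cosIZ a b c p : cosI a b (c *: p) = c * cosI a b p.
Proof.
rewrite /cosI; under eq_Rintegral do rewrite hornerZ.
by rewrite RintegralZl//; exact: integrable_horner_cos.
Qed.

Lemma cosIN a b p : cosI a b (- p) = - cosI a b p.
Proof. by rewrite -scaleN1r cosIZ mulN1r. Qed.

Lemma cosI0 a b : cosI a b 0 = 0.
Proof. by rewrite -(scale0r (0 : {poly R})) cosIZ mul0r. Qed.

Lemma cosI_chebT0 a b : a < b -> cosI a b (chebT 0) = b - a.
Proof.
move=> ab; rewrite /cosI; under eq_Rintegral do rewrite chebT0 hornerC.
by rewrite Rintegral_cst//= lebesgue_measure_itv/= lte_fin ab mul1r.
Qed.

Lemma cosI_chebTS a b m : a < b ->
  cosI a b (chebT m.+1) = (sin (m.+1%:R * b) - sin (m.+1%:R * a)) / m.+1%:R.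
Proof.
move=> ab; pose F t : R := sin (m.+1%:R * t) / m.+1%:R.
have m0 : m.+1%:R != 0 :> R by rewrite pnatr_eq0.
have dF t : is_derive t 1 F ((chebT m.+1).[cos t]).
  rewrite chebTE /F; apply: is_derive_eq.
  by rewrite /GRing.scale/=; field.
have cF t : {for t, continuous F}.
  by apply: differentiable_continuous; exact/derivable1_diffP.
rewrite /cosI /Rintegral (continuous_FTC2 (F := F))//.
- by rewrite -EFinB /= mulrBl.
- by apply: continuous_subspaceT; exact: continuous_horner_cos.
- split; first by move=> t _; exact: ex_derive.
  + exact/cvg_at_right_filter/cF.
  + exact/cvg_at_left_filter/cF.
- by move=> t _; rewrite derive1E derive_val.
Qed.

Lemma cosI_wpoly_neq0 Q : cosI 0 pi (wpoly Q) != 0.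
Proof.
have I0 : cosI 0 pi 1 = pi.
  by rewrite -chebT0 cosI_chebT0 ?subr0// pi_gt0.
have I1 : cosI 0 pi 'X = 0.
  by rewrite -chebT1 cosI_chebTS ?pi_gt0// mul1r mulr0 sinpi sin0 subrr mul0r.
(* T_2 = 2 X^2 - 1 has integral 0 over [0, pi]. *)
have I2 : 2 * cosI 0 pi ('X ^+ 2) = pi.
  have := @cosI_chebTS 0 pi 1 (pi_gt0 R).
  rewrite chebTS chebT1 chebT0 -expr2 cosID cosIN cosIZ I0 mulr0 sin0.
  rewrite (mulr_natl pi) sin2pi subrr mul0r => /eqP.
  by rewrite subr_eq0 => /eqP.
have := pi_gt0 R; case: Q => /= p0; rewrite ?(cosID, cosIN) ?I0 ?I1.
- by rewrite gt_eqF.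
- by apply/eqP => h; move: p0 I2; lra.
- by rewrite addr0 gt_eqF.
- by rewrite subr0 gt_eqF.
Qed.

Lemma Rintegral_weight_neq0 Q : \int[mu]_(x in `]-1, 1[) weight Q x != 0.
Proof.
have <- : cosI 0 pi (wpoly Q) = \int[mu]_(x in `]-1, 1[) weight Q x.
  rewrite -[wpoly Q]mul1r /cosI -Rintegral_horner_weight ?pi_gt0//.
  rewrite cospi cos0 /Rintegral integral_itv_bndoo.
    by congr fine; apply: eq_integral => x _; rewrite hornerC mul1r.
  apply/measurable_EFinP.
  exact: (continuous_measurable_fun_oo _ _ (@continuous_horner_weight 1 Q)).
exact: cosI_wpoly_neq0.
Qed.

(** As [psi] is a choice by [xget], its properties follow once some polynomial satisfies them: an
    antiderivative of [dpsi], shifted to have weighted mean zero. *)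
Lemma deriv_psi Q N j : (j < N)%N -> (psi Q N j)^`() = dpsi Q N j :> {poly R}.
Proof.
move=> jN; suff hP : exists p : {poly R}, [/\ (size p <= N.+1)%N,
    \int[mu]_(x in `]-1, 1[) (p.[x] * weight Q x) = 0 & p^`() = dpsi Q N j].
  by have [] := xgetPex 0 hP.
have [p sp dp] := @poly_antiderivative R _ _ (size_dpsi Q jN).
have iw : mu.-integrable `]-1, 1[ (EFin \o (fun x => weight Q x)).
  apply: eq_integrable (integrable_horner_weight 1 Q) => // x _ /=.
  by rewrite hornerC mul1r.
(* The weighted mean of p; the total mass of the weight is nonzero. *)
pose c := (\int[mu]_(x in `]-1, 1[) (p.[x] * weight Q x)) /
          \int[mu]_(x in `]-1, 1[) weight Q x.
exists (p - c%:P); split.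
- by rewrite (leq_trans (size_polyD _ _))// geq_max sp size_polyN
    (leq_trans (size_polyC_leq1 _)).
- under eq_Rintegral do rewrite hornerD hornerN hornerC mulrBl.
  rewrite RintegralB ?RintegralZl//.
  + by rewrite /c divfK ?subrr// Rintegral_weight_neq0.
  + exact: integrable_horner_weight.
  + apply: eq_integrable (integrable_horner_weight c%:P Q) => // x _ /=.
    by rewrite hornerC.
- by rewrite derivB derivC subr0.
Qed.

End WeightedIntegrals.

(** * Integrals over the cells and discrete orthogonality at their midpoints *)

Section Cells.
Context {R : realType}.
Implicit Types (N i j k l m : nat) (Q : chebKind).

Lemma sin_natpi k : sin (k%:R * pi) = 0 :> R.
Proof.
elim: k => [|k IH]; first by rewrite mul0r sin0.
by rewrite -natr1 mulrDl mul1r sinDpi IH oppr0.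
Qed.

Lemma theta_ge0 N i : 0 <= theta N i :> R.
Proof. by rewrite /theta divr_ge0// mulr_ge0// pi_ge0. Qed.

Lemma theta_ltS N i : (0 < N)%N -> theta N i < theta N i.+1 :> R.
Proof.
move=> N0; rewrite /theta ltr_pM2r ?invr_gt0 ?ltr0n//.
by rewrite ltr_pM2r ?pi_gt0// ltr_nat.
Qed.

Lemma theta_lepi N i : (0 < N)%N -> (i <= N)%N -> theta N i <= pi :> R.
Proof.
move=> N0 iN; rewrite /theta ler_pdivrMr ?ltr0n// mulrC.
by rewrite ler_wpM2l ?pi_ge0// ler_nat.
Qed.

Lemma natr_theta N i : (0 < N)%N -> N%:R * theta N i = i%:R * pi :> R.
Proof. by move=> N0; rewrite /theta; field; rewrite pnatr_eq0 -lt0n. Qed.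

Lemma cosI_chebT_N N i : (0 < N)%N ->
  cosI (theta N i) (theta N i.+1) (chebT N) = 0 :> R.
Proof.
case: N => // N _; rewrite cosI_chebTS ?theta_ltS// !natr_theta//.
by rewrite !sin_natpi subrr mul0r.
Qed.

(* The increments of sin ((N - 1) theta) and of - sin ((N + 1) theta) over a
   cell agree, since N theta is a multiple of pi at the nodes; the weight
   (N + 1) / N of U_(N-1) makes the two contributions cancel. *)
Lemma cosI_chebT_around_N N i : (0 < N)%N ->
  let I m := cosI (theta N i) (theta N i.+1) (chebT m) in
  - I N.-1 + N.+1%:R / (2 * N%:R) * (I N.-1 - I N.+1) = 0 :> R.
Proof.
move=> N0 I; pose u k : R := cos (k%:R * pi) * sin (theta N k).
have uP k : sin (N.+1%:R * theta N k) = u k.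
  by rewrite -natr1 mulrDl mul1r natr_theta// sinD sin_natpi mul0r add0r.
have uM k : sin (N.-1%:R * theta N k) = - u k.
  by rewrite -subn1 natrB// mulrBl mul1r natr_theta// sinB sin_natpi mul0r sub0r.
have IP : I N.+1 = (u i.+1 - u i) / N.+1%:R.
  by rewrite /I cosI_chebTS ?theta_ltS// !uP.
case: N N0 @I u uP uM IP => [//|[|n]] _ I u uP uM IP.
  (* N = 1 is separate because T_0 does not integrate to a sine. The coefficient (N + 1) / (2N) is
     then 1, so the T_0 terms cancel, and [uM] forces u to vanish at both ends. *)
  rewrite IP /=; have := uM i; have := uM i.+1; rewrite /= !mul0r sin0.
  move=> /esym/eqP; rewrite oppr_eq0 => /eqP -> /esym/eqP.
  by rewrite oppr_eq0 => /eqP ->; rewrite subrr mul0r subr0; field.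
have IM : I n.+1 = - (u i.+1 - u i) / n.+1%:R.
  by rewrite /I cosI_chebTS ?theta_ltS// !uM; ring.
rewrite /= IM IP -[n.+3%:R]natr1 -[n.+2%:R]natr1 -[n.+1%:R]natr1.
have n0 : 0 <= n%:R :> R by [].
by field; apply/andP; split; [|apply/andP; split]; apply: lt0r_neq0; lra.
Qed.

Lemma cosI_dpsi_rem Q N i j : (0 < N)%N ->
  cosI (theta N i) (theta N i.+1) (dpsi_rem Q N j) = 0 :> R.
Proof.
move=> N0; case: Q; rewrite /dpsi_rem ?cosI0 ?cosIN ?cosIZ ?cosI_chebT_N//.
- case: ifP => _; first by rewrite cosIN cosI_chebT_N ?oppr0.
  by rewrite cosID cosIN cosIZ cosID cosIN cosI_chebT_around_N.
- by rewrite mulr0 oppr0.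
- by rewrite oppr0.
Qed.

(** Here the four kinds collapse to one matrix: only the remainder depends on Q, and its cell
    integrals are zero. *)
Lemma DpsiE Q N (i j : 'I_N) :
  Dpsi Q N i j = cosI (theta N i) (theta N i.+1) (chebT j) :> R.
Proof.
have N0 : (0 < N)%N by case: (N) j => [[]|].
rewrite mxE deriv_psi// Rintegral_horner_weight ?theta_ge0 ?theta_ltS//.
  by rewrite dpsi_wpoly// -/(cosI _ _ _) cosID cosI_dpsi_rem// addr0.
by rewrite theta_lepi.
Qed.

(** The midpoint of [theta_i, theta_(i+1)]; the cosines of these angles are the zeros of T_N. *)
Definition midangle N i : R := (2 * i%:R + 1) * (pi / (2 * N%:R)).

(** The value at m = 0 is the limit of the other formula as m tends to 0. *)
Definition cellscale N m : R :=
  if m == 0%N then pi / N%:R else 2 * sin (m%:R * pi / (2 * N%:R)) / m%:R.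

(** The ends of the cell are its midpoint plus and minus pi / (2N), and sin(A + B) - sin(A - B) = 2
    cos A sin B. *)
Lemma cosI_cell N i m : (0 < N)%N ->
  cosI (theta N i) (theta N i.+1) (chebT m) =
  cellscale N m * cos (m%:R * midangle N i).
Proof.
move=> N0; have Nn : N%:R != 0 :> R by rewrite pnatr_eq0 -lt0n.
case: m => [|m]; rewrite /cellscale/=.
  rewrite cosI_chebT0 ?theta_ltS// mul0r cos0 mulr1 /theta -natr1.
  by field.
rewrite cosI_chebTS ?theta_ltS// mulrAC; congr (_ / _).
set M := m.+1%:R.
have -> : M * theta N i.+1 = M * midangle N i + M * pi / (2 * N%:R).
  by rewrite /theta /midangle -natr1; field.
have -> : M * theta N i = M * midangle N i - M * pi / (2 * N%:R).
  by rewrite /theta /midangle; field.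
by rewrite sinD sinB; ring.
Qed.

Lemma sum_cos_midangle N l : (l < 2 * N)%N ->
  \sum_(i < N) cos (l%:R * midangle N i) = if l == 0%N then N%:R else 0.
Proof.
case: eqP => [-> _|/eqP l0 lN].
  under eq_bigr do rewrite mul0r cos0.
  by rewrite sumr_const card_ord.
have N0 : (0 < N)%N by lia.
have Nn : N%:R != 0 :> R by rewrite pnatr_eq0 -lt0n.
(* Multiplying by 2 sin b makes the sum telescope to sin(l pi) - sin 0 = 0; the bounds 0 < l < 2N
   put b in ]0, pi[, so sin b can be cancelled. *)
pose b : R := l%:R * pi / (2 * N%:R).
have sb : sin b != 0.
  apply/lt0r_neq0/sin_gt0_pi; rewrite /b.
  rewrite divr_gt0 ?mulr_gt0 ?pi_gt0 ?ltr0n ?lt0n//=; last by rewrite -lt0n.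
  rewrite ltr_pdivrMr; last by rewrite mulr_gt0// ltr0n.
  by rewrite mulrC ltr_pM2l ?pi_gt0// -natrM ltr_nat.
apply: (mulfI (mulf_neq0 (_ : 2 != 0 :> R) sb)); first by [].
rewrite mulr0 mulr_sumr.
under eq_bigr => i _.
  rewrite (_ : 2 * sin b * _ =
    sin (i.+1%:R * (2 * b)) - sin (i%:R * (2 * b))); last first.
    have -> : i.+1%:R * (2 * b) = l%:R * midangle N i + b.
      by rewrite /midangle /b -natr1; field.
    have -> : i%:R * (2 * b) = l%:R * midangle N i - b.
      by rewrite /midangle /b; field.
    by rewrite sinD sinB; ring.
  over.
rewrite -(big_mkord xpredT (fun i => sin (i.+1%:R * (2 * b)) -
  sin (i%:R * (2 * b)))) telescope_sumr// mul0r sin0 subr0.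
by rewrite (_ : N%:R * (2 * b) = l%:R * pi) ?sin_natpi// /b; field.
Qed.

Lemma sum_cos_cos_midangle N j k : (j < N)%N -> (k < N)%N ->
  \sum_(i < N) cos (j%:R * midangle N i) * cos (k%:R * midangle N i) =
  if j == k then (if j == 0%N then N%:R else N%:R / 2) else 0.
Proof.
(* Symmetry makes the natural-number difference j - k a true one; j - k and j + k both stay below
   2N. *)
wlog kj : j k / (k <= j)%N => [hw jN kN|jN kN].
  have [|/ltnW] := leqP k j; first by move=> ?; exact: hw.
  move=> jk; rewrite eq_sym.
  under eq_bigr do rewrite mulrC.
  by rewrite hw//; case: eqP => // ->.
transitivity (2^-1 * (\sum_(i < N) cos ((j - k)%:R * midangle N i) +
                      \sum_(i < N) cos ((j + k)%:R * midangle N i))).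
  rewrite -big_split/= mulr_sumr; apply: eq_bigr => i _.
  by rewrite natrB// natrD mulrBl mulrDl cosB cosD; field.
rewrite !sum_cos_midangle; [|lia..].
rewrite subn_eq0 addn_eq0.
have -> : (j <= k)%N = (j == k) by lia.
case: (eqVneq j k) => [->|jk].
  by rewrite andbb; case: ifP => _; rewrite ?addr0; field.
have -> : (j == 0%N) && (k == 0%N) = false by lia.
by rewrite addr0 mulr0.
Qed.

End Cells.

Theorem mainTheorem10 (R : realType) (N : nat) (hN : (1 <= N)%N)
    (Q : chebKind) :
  (forall j : 'I_N, col j (Dpsi Q N) = bvec N j :> 'cV[R]_N) /\
  (Dpsi Q N)^T *m Dpsi Q N = diag_mx (\row_(k < N) (lambda k : R)) :> 'M[R]_N.
Proof.
split=> [j|].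
  apply/colP => i; rewrite mxE DpsiE /cosI mxE.
  by under eq_Rintegral do rewrite chebTE.
have Nn : N%:R != 0 :> R by rewrite pnatr_eq0 -lt0n.
apply/matrixP => j k; rewrite !mxE.
under eq_bigr => i _.
  rewrite mxE !DpsiE !cosI_cell// mulrACA.
  over.
rewrite -mulr_sumr sum_cos_cos_midangle// /cellscale /lambda.
rewrite (inj_eq val_inj); case: (eqVneq j k) => [<-|_]; last by rewrite mulr0.
(* The diagonal entry is (pi / N)^2 N at index 0, and [cellscale] squared times N / 2 at the
   others. *)
case: eqP => [_|/eqP k0]; rewrite mulr1n; first by field.
by field; rewrite ?pnatr_eq0 ?k0.
Qed.
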